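(* Let $d \ge k \ge 0$ be integers. Let $G=(\mathbb{Z}_2)^{d-k+1}$, where $\mathbb{Z}_2=\{+1,-1\}$ under multiplication, with generators $m_0,m_1,\dots,m_{d-k}$ ($m_i$ has $-1$ in the coordinate indexed by $i$ and $+1$ elsewhere). Let $G$ act on $X = S^d \times V_{d-k}(\mathbb{R}^d)$ by $$(\lambda_0,\lambda_1,\dots,\lambda_{d-k})\cdot(w,v_1,\dots,v_{d-k}) = (\lambda_0 w, \lambda_1 v_1,\dots,\lambda_{d-k}v_{d-k}),$$ and let $G$ act on $R=\mathbb{R}^d\times\mathbb{R}^{d-1}\times\cdots\times\mathbb{R}^k$, whose elements are written $(x_0,x_1,\dots,x_{d-k})$ with $x_i\in\mathbb{R}^{d-i}$, as follows: for $1\le i\le d-k$, $m_i$ changes the sign of every coordinate of $x_i$ and leaves everything else unchanged; $m_0$ changes the sign of every coordinate of $x_0$ and of the first coordinate of each of $x_1,\dots,x_{d-k}$, leaving all other coordinates unchanged. Then every continuous $G$-equivariant map $f: X \to R$ has a zero.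
   Context: $S^d\subset\mathbb{R}^{d+1}$ is the unit sphere. $V_{j}(\mathbb{R}^d)$ denotes the Stiefel manifold of ordered orthonormal $j$-frames $(v_1,\dots,v_j)$ in $\mathbb{R}^d$; $V_0(\mathbb{R}^d)$ is a point. When $k=d$, $R=\mathbb{R}^d$ and the factors $\mathbb{R}^0=\{0\}$ are trivial. *)

(* Defs.v *)
From HB Require Import structures.
From mathcomp Require Import all_boot all_order all_algebra.
From mathcomp Require Import all_classical all_reals all_analysis.
Set Implicit Arguments. Unset Strict Implicit. Unset Printing Implicit Defensive.
Import Order.TTheory GRing.Theory Num.Theory.
Local Open Scope ring_scope.
Local Open Scope classical_set_scope.

Definition sphere (R : realType) (d : nat) : set 'rV[R]_d.+1 :=
  [set w | \sum_(i < d.+1) w ord0 i ^+ 2 = 1].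

(* Stiefel manifold V_j(R^n): ordered orthonormal j-frames (v_1,...,v_j),
   stored as the rows of a j x n matrix. V_0 is a point (the empty matrix). *)
Definition stiefel (R : realType) (j n : nat) : set 'M[R]_(j, n) :=
  [set V | V *m V^T = 1%:M].

Definition sgn (R : realType) (b : bool) : R := if b then -1 else 1.

(* G = (Z_2)^(d-k+1): lambda_i = sgn (g i), i = 0..d-k. *)
Definition Zgrp (n : nat) := {ffun 'I_n.+1 -> bool}.

(* Action on X = S^d x V_{d-k}(R^d): w |-> lambda_0 w, v_j |-> lambda_j v_j
   (row j0 : 'I_(d-k) of the matrix is v_(j0+1)). *)
Definition actX (R : realType) (d n : nat) (g : Zgrp n)
  (p : 'rV[R]_d.+1 * 'M[R]_(n, d)) : 'rV[R]_d.+1 * 'M[R]_(n, d) :=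
  (sgn R (g ord0) *: p.1,
   \matrix_(j < n, c < d) (sgn R (g (lift ord0 j)) * p.2 j c)).

(* Action on the component x_i in R^(d-i) of R = R^d x ... x R^k:
   m_i (i >= 1) negates x_i; m_0 negates x_0 and the first coordinate of
   each x_i, i >= 1. The general element acts by the composite. *)
Definition actR (R : realType) (d n : nat) (g : Zgrp n) (i : 'I_n.+1)
  (x : 'rV[R]_(d - i)) : 'rV[R]_(d - i) :=
  \row_(c < d - i)
    (if i == ord0 then sgn R (g ord0) * x ord0 c
     else sgn R (g i) * (if c == 0%N :> nat then sgn R (g ord0) else 1) * x ord0 c).

(* Main.v *)
(** A Stiefel manifold is cut out of a product of spheres by the equations
    <v_i, v_j> = 0 for i < j, each odd under the sign changes of v_i and of v_j.
    Adding them to the components of f gives a system of as many equations on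
    S^d x (S^(d-1))^(d-k) as the dimension of that product, each equivariant for a
    character of G.  If the product of the characters, read as linear forms in
    F_2[t_0, ..., t_(d-k)] / (t_0^(d+1), t_i^d), is nonzero, then the system has a
    solution: the characteristic class of an equation vanishes where the equation
    does not.  Here the product is
    t_0^d * prod_i (t_i + t_0) t_i^(d-i-1) * prod_(i<j) (t_i + t_j), where t_0^d
    turns each factor t_i + t_0 into t_i; then t_1 has exponent d - 1, which turns
    t_1 + t_j into t_j, and so on, leaving the top monomial.

    The cohomological argument is carried out with explicit cochains mod 2 on fine
    cubical grids of products of cube surfaces.  A nonzero value yields, at every
    scale, a flag of cells along which every equation changes sign, and by
    compactness these flags accumulate at a common zero. *)

Require Import Defs.
From HB Require Import structures.
From mathcomp Require Import all_boot all_order all_algebra.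
From mathcomp Require Import all_classical all_reals all_analysis.
From mathcomp Require Import zify lra.
Set Implicit Arguments. Unset Strict Implicit. Unset Printing Implicit Defensive.
Import Order.TTheory GRing.Theory Num.Theory.
Import numFieldNormedType.Exports.

(** * Mod 2 chains on the cubical grid *)

Notation "\xor_ ( i <- r ) F" := (\big[addb/false]_(i <- r) F%B)
  (at level 36, i, r at level 50, F at level 36,
   format "'[' \xor_ ( i <- r ) '/  ' F ']'").

Section ListFaces.
Variables (A : Type) (f : A -> seq A).

(* The facets of a product of cells, given the facets of its factors. *)
Fixpoint lfaces (l : seq A) : seq (seq A) :=
  if l is a :: l' then [seq a' :: l' | a' <- f a] ++ [seq a :: l'' | l'' <- lfaces l']
  else [::].

Lemma xor_lfaces_cons phi a l :
  \xor_(q <- lfaces (a :: l)) phi q =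
  (\xor_(a' <- f a) phi (a' :: l)) (+) (\xor_(l' <- lfaces l) phi (a :: l')).
Proof. by rewrite /= big_cat !big_map. Qed.

Lemma xor_lfaces_prod phi c c' :
  \xor_(p <- [seq a :: l | a <- c, l <- c']) \xor_(q <- lfaces p) phi q =
  (\xor_(l <- c') \xor_(a <- c) \xor_(a' <- f a) phi (a' :: l)) (+)
  (\xor_(a <- c) \xor_(l <- c') \xor_(l' <- lfaces l) phi (a :: l')).
Proof.
rewrite big_allpairs_dep exchange_big -[in RHS]exchange_big -big_split exchange_big /=.
apply: eq_bigr => a _; rewrite -big_split; apply: eq_bigr => l _ /=.
by rewrite -xor_lfaces_cons.
Qed.

Definition faces_even := forall a, \xor_(a' <- f a) true = false.

(** Mod 2 chains are plain lists of cells, seen only through the values of cochains on them; in this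
    dual form, the boundary of a boundary vanishes. *)
Definition faces_closed := forall (phi : A -> bool) a,
  \xor_(a' <- f a) \xor_(a'' <- f a') phi a'' = false.

End ListFaces.

Lemma lfaces_even A (f : A -> seq A) : faces_even f -> faces_even (lfaces f).
Proof.
move=> fev; elim=> [|a l IH]; first by rewrite big_nil.
by rewrite xor_lfaces_cons fev IH.
Qed.

Lemma lfaces_closed A (f : A -> seq A) : faces_closed f -> faces_closed (lfaces f).
Proof.
move=> fcl phi l; elim: l phi => [|a l IH] phi; first by rewrite big_nil.
rewrite xor_lfaces_cons.
under eq_bigr do rewrite xor_lfaces_cons.
under [X in _ (+) X]eq_bigr do rewrite xor_lfaces_cons.
rewrite !big_split /= (fcl (fun a' => phi (a' :: l))) (IH (fun l' => phi (a :: l'))).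
(* The mixed terms, with one facet in the head and one in the tail, occur twice. *)
by rewrite addbF addFb exchange_big addbb.
Qed.

(** * Cup products of sign coboundaries, counted by flags *)

Section Flags.
Variables (C E : Type) (F : C -> seq C) (s : E -> C -> bool).
Hypotheses (Fev : faces_even F) (Fcl : faces_closed F).

(* The parity of the number of flags p = p_0 > p_1 > ... below p such that the
   a-th sign function changes between p_a and p_(a+1): the cup product of the
   coboundaries of the sign functions, evaluated on the barycentric subdivision
   of p. *)
Fixpoint flags (es : seq E) (p : C) : bool :=
  if es is e :: es' then \xor_(q <- F p) ((s e p (+) s e q) && flags es' q)
  else true.

(** By induction [flags es] is a cocycle: the terms carrying the sign of the outer cell vanish by
    the induction hypothesis, and the rest is a coboundary, killed by [Fcl]. *)
Lemma xor_flags_faces es p : \xor_(q <- F p) flags es q = false.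
Proof.
elim: es p => [|e es IH] p /=; first exact: Fev.
under eq_bigr => q _ do [under eq_bigr do rewrite andb_addl; rewrite big_split /=
  -big_distrr /= IH andbF addFb].
exact: Fcl.
Qed.

(** A nonempty product is thus an exact cochain, so that its sum over a chain moves to the boundary
    of the chain. *)
Lemma flags_cons e es p : flags (e :: es) p = \xor_(q <- F p) (s e q && flags es q).
Proof.
rewrite /=; under eq_bigr do rewrite andb_addl.
by rewrite big_split /= -big_distrr /= xor_flags_faces andbF addFb.
Qed.

End Flags.

(* An even integer is a vertex of the grid on the line, an odd one the edge
   joining its two neighbours; in all dimensions a cell is thus identified with
   its barycenter. *)
Definition ifaces (x : int) : seq int :=
  if odd `|x|%N then [:: x - 1; x + 1]%R else [::].

Lemma ifaces_even : faces_even ifaces.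
Proof. by move=> x; rewrite /ifaces; case: ifP => _; rewrite ?big_cons ?big_nil. Qed.

Lemma ifaces_closed : faces_closed ifaces.
Proof.
move=> phi x; case ox: (odd `|x|%N); last by rewrite {1}/ifaces ox big_nil.
by rewrite {1}/ifaces ox !big_cons /ifaces !ifF ?big_nil //; lia.
Qed.

Notation rfaces := (lfaces ifaces).
Notation cfaces := (lfaces rfaces).

Definition rneg (r : seq int) : seq int := [seq (- x)%R | x <- r].

Lemma xor_ifacesN phi x :
  \xor_(y <- ifaces (- x)) phi y = \xor_(y <- ifaces x) phi (- y)%R.
Proof.
rewrite /ifaces abszN; case: ifP => _; rewrite ?big_nil // !big_cons !big_nil !addbF.
by rewrite addbC opprB opprD addrC.
Qed.

Lemma xor_rfacesN phi r :
  \xor_(q <- rfaces (rneg r)) phi q = \xor_(q <- rfaces r) phi (rneg q).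
Proof.
elim: r phi => [|x r IH] phi; first by rewrite /= !big_nil.
rewrite [rneg _]/= !xor_lfaces_cons xor_ifacesN.
by rewrite (IH (fun l => phi ((- x)%R :: l))).
Qed.

(** * Cubes, cube surfaces and hemispheres *)

Section Hemisphere.
Variable L : nat.

Definition ihalf : seq int := [seq Posz (2 * k + 1) | k <- iota 0 L].
Definition ifull : seq int := ihalf ++ [seq (- x)%R | x <- ihalf].
Definition top : int := Posz (2 * L).

Lemma xor_ihalf phi :
  \xor_(x <- ihalf) \xor_(y <- ifaces x) phi y = phi top (+) phi 0%R.
Proof.
rewrite /ihalf /top; elim: L => [|l IH].
  by rewrite big_nil muln0 addbb.
rewrite -[l.+1]addn1 iotaD map_cat big_cat IH /= big_cons big_nil /ifaces ifT; last by lia.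
rewrite !big_cons big_nil !addbF.
rewrite (_ : (Posz (2 * (0 + l) + 1) - 1)%R = Posz (2 * l)); last by lia.
rewrite (_ : (Posz (2 * (0 + l) + 1) + 1)%R = Posz (2 * (l + 1))); last by lia.
by case: (phi _); case: (phi 0%R); case: (phi _).
Qed.

Lemma xor_ifull phi :
  \xor_(x <- ifull) \xor_(y <- ifaces x) phi y = phi top (+) phi (- top)%R.
Proof.
rewrite /ifull big_cat /= xor_ihalf big_map.
under eq_bigr do rewrite xor_ifacesN.
rewrite (xor_ihalf (fun y => phi (- y)%R)) oppr0.
by rewrite addbACA addbb addbF.
Qed.

Lemma xor_ifullN phi : \xor_(x <- ifull) phi (- x)%R = \xor_(x <- ifull) phi x.
Proof.
rewrite /ifull !big_cat /= ![\xor_(x <- map _ ihalf) _]big_map addbC; congr (_ (+) _).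
by apply: eq_bigr => x _; rewrite opprK.
Qed.

(** The top-dimensional cells of the solid n-cube of half-side [top]. *)
Fixpoint box n : seq (seq int) :=
  if n is n'.+1 then [seq x :: r | x <- ifull, r <- box n'] else [:: [::]].

(** The surface of that cube, by the Leibniz rule for a segment times a cube; [shell 0] is empty
    since a point has no boundary. *)
Fixpoint shell n : seq (seq int) :=
  if n is n'.+1 then [seq x :: r | x <- ifull, r <- shell n']
    ++ ([seq top :: r | r <- box n'] ++ [seq (- top)%R :: r | r <- box n']) else [::].

Lemma boxS n : box n.+1 = [seq x :: r | x <- ifull, r <- box n].
Proof. by []. Qed.

Lemma shellS n : shell n.+1 = [seq x :: r | x <- ifull, r <- shell n]
  ++ ([seq top :: r | r <- box n] ++ [seq (- top)%R :: r | r <- box n]).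
Proof. by []. Qed.

(* The top-dimensional cells of the half of the cube surface in R^(n+1) on
   which the first coordinate is positive. *)
Definition hemi n : seq (seq int) :=
  [seq x :: r | x <- ihalf, r <- shell n] ++ [seq top :: r | r <- box n].

Lemma xor_box_faces phi n :
  \xor_(p <- box n) \xor_(q <- rfaces p) phi q = \xor_(q <- shell n) phi q.
Proof.
elim: n phi => [|n IH] phi; first by rewrite /= big_cons !big_nil.
rewrite boxS xor_lfaces_prod shellS [RHS]big_cat /= ![\xor_(q <- flatten _) _]big_allpairs_dep.
rewrite addbC; congr (_ (+) _).
  by apply: eq_bigr => x _; exact: (IH (fun q => phi (x :: q))).
rewrite [RHS]big_cat /= ![\xor_(q <- map _ (box n)) _]big_map -big_split.
by apply: eq_bigr => r _; rewrite (xor_ifull (fun y => phi (y :: r))).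
Qed.

Lemma xor_shell_faces phi n : \xor_(p <- shell n) \xor_(q <- rfaces p) phi q = false.
Proof.
rewrite -(xor_box_faces (fun p => \xor_(q <- rfaces p) phi q)).
by rewrite big1 // => p _; exact: (lfaces_closed ifaces_closed).
Qed.

Lemma xor_boxN phi n : \xor_(p <- box n) phi (rneg p) = \xor_(p <- box n) phi p.
Proof.
elim: n phi => [|n IH] phi; first by rewrite /= !big_cons !big_nil.
rewrite boxS ![\xor_(q <- flatten _) _]big_allpairs_dep.
rewrite -[RHS](xor_ifullN (fun x => \xor_(r <- box n) phi (x :: r))).
by apply: eq_bigr => x _; exact: (IH (fun r => phi ((- x)%R :: r))).
Qed.

Lemma xor_hemi phi n :
  \xor_(q <- hemi n) phi q =
  (\xor_(x <- ihalf) \xor_(r <- shell n) phi (x :: r)) (+) \xor_(r <- box n) phi (top :: r).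
Proof.
rewrite /hemi big_cat /= [\xor_(q <- flatten _) _]big_allpairs_dep.
by rewrite [\xor_(q <- map _ (box n)) _]big_map.
Qed.

Lemma xor_shell phi n :
  \xor_(q <- shell n.+1) phi q = \xor_(q <- hemi n) (phi q (+) phi (rneg q)).
Proof.
(* The shell inherits the antipodal symmetry of the solid cube that it bounds. *)
have shellN psi : \xor_(p <- shell n) psi (rneg p) = \xor_(p <- shell n) psi p.
  rewrite -!(xor_box_faces psi) -xor_boxN -(xor_box_faces (psi \o rneg)).
  by apply: eq_bigr => p _; rewrite xor_rfacesN.
have ifullE psi : \xor_(x <- ifull) psi x = \xor_(x <- ihalf) (psi x (+) psi (- x)%R).
  by rewrite /ifull big_cat /= [\xor_(x <- map _ ihalf) _]big_map big_split.
rewrite shellS big_cat big_cat big_split !xor_hemi /=.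
rewrite [\xor_(q <- flatten _) _]big_allpairs_dep ifullE big_split /=.
rewrite ![\xor_(q <- map _ (box n)) _]big_map.
rewrite (xor_boxN (fun r => phi ((- top)%R :: r))) addbACA; congr (_ (+) (_ (+) _)).
by apply: eq_bigr => x _; rewrite -(shellN (fun r => phi ((- x)%R :: r))).
Qed.

(** The side wall, [ihalf] times [shell n], ends at 0 and at [top]; its upper end cancels the rim of
    the top face, and the equator remains. *)
Lemma xor_hemi_faces phi n :
  \xor_(p <- hemi n) \xor_(q <- rfaces p) phi q = \xor_(q <- shell n) phi (0%R :: q).
Proof.
rewrite /hemi big_cat /= xor_lfaces_prod big_map /=.
under eq_bigr => r _ do rewrite (xor_ihalf (fun y => phi (y :: r))).
rewrite [X in (_ (+) X) (+) _]big1 => [|x _]; last first.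
  exact: (xor_shell_faces (fun q => phi (x :: q))).
have -> : \xor_(i <- box n) \xor_(q <- rfaces (top :: i)) phi q
   = \xor_(q <- shell n) phi (top :: q).
  rewrite -xor_box_faces; apply: eq_bigr => r _.
  by rewrite xor_lfaces_cons {1}/ifaces ifF ?big_nil // /top; lia.
by rewrite big_split addbF addbAC addbb addFb.
Qed.

(* Padding with zeros makes the boundary of the n-th chain the antipodal double
   of the previous one, in the same ambient space. *)
Definition padded_hemi D n := [seq nseq (D - n) 0%R ++ r | r <- hemi n].

Lemma xor_zeros_faces phi k r :
  \xor_(q <- rfaces (nseq k 0%R ++ r)) phi q = \xor_(q <- rfaces r) phi (nseq k 0%R ++ q).
Proof.
elim: k phi => [//|k IH] phi; rewrite [nseq _ _ ++ _]/= xor_lfaces_cons big_nil addFb.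
by rewrite (IH (fun q => phi (0%R :: q))).
Qed.

Lemma rneg_zeros k r : rneg (nseq k 0%R ++ r) = nseq k 0%R ++ rneg r.
Proof. by rewrite /rneg map_cat map_nseq oppr0. Qed.

Lemma xor_padded_hemi_faces phi D n : n <= D ->
  \xor_(p <- padded_hemi D n) \xor_(q <- rfaces p) phi q =
  (0 < n) && \xor_(q <- padded_hemi D n.-1) (phi q (+) phi (rneg q)).
Proof.
move=> nD; rewrite /padded_hemi !big_map.
under eq_bigr do rewrite xor_zeros_faces.
rewrite (xor_hemi_faces (fun q => phi (nseq (D - n) 0%R ++ q))).
case: n nD => [|n] nD; first by rewrite big_nil.
rewrite (xor_shell (fun q => phi (nseq (D - n.+1) 0%R ++ 0%R :: q))) /=.
under [RHS]eq_bigr do rewrite rneg_zeros.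
rewrite -[D - n]/(D.+1 - n.+1) subSn //.
(* The zero coordinate of the equator joins the padding, which is one longer for the smaller
   hemisphere. *)
have E q : nseq (D - n.+1).+1 0%R ++ q = nseq (D - n.+1) 0%R ++ 0%R :: q :> seq int.
  by elim: (D - n.+1) => //= k ->.
by apply: eq_bigr => q _; rewrite !E.
Qed.

End Hemisphere.

(** * Products of hemispheres and their boundaries *)

Fixpoint cneg i (p : seq (seq int)) : seq (seq int) :=
  match p, i with
  | r :: p', 0 => rneg r :: p'
  | r :: p', i'.+1 => r :: cneg i' p'
  | [::], _ => [::]
  end.

Lemma xor_cfaces_cneg phi i p :
  \xor_(q <- cfaces (cneg i p)) phi q = \xor_(q <- cfaces p) phi (cneg i q).
Proof.
elim: p i phi => [|r p IH] [|i] phi; rewrite ?big_nil //.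
  by rewrite [cneg _ _]/= !xor_lfaces_cons xor_rfacesN.
rewrite [cneg _ _]/= !xor_lfaces_cons.
by rewrite (IH i (fun l => phi (r :: l))).
Qed.

Definition lower (J : nat -> nat) j i := J i - (i == j).

Section Chain.
Variable L : nat.

Fixpoint chain (Ds : seq nat) (J : nat -> nat) : seq (seq (seq int)) :=
  if Ds is D :: Ds' then
    [seq r :: p | r <- padded_hemi L D (J 0), p <- chain Ds' (J \o S)]
  else [:: [::]].

Lemma chain_cons D Ds J :
  chain (D :: Ds) J = [seq r :: p | r <- padded_hemi L D (J 0), p <- chain Ds (J \o S)].
Proof. by []. Qed.

Lemma eq_chain Ds J J' : (forall i, i < size Ds -> J i = J' i) ->
  chain Ds J = chain Ds J'.
Proof.
elim: Ds J J' => [//|D Ds IH] J J' eqJ.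
rewrite !chain_cons (eqJ 0) // (IH (J \o S) (J' \o S)) // => i iD.
exact: eqJ.
Qed.

(** The Leibniz rule for a product of hemispheres. The guard [0 < J i] is there because a point has
    empty boundary, while [lower] truncates at 0. *)
Lemma xor_chain_faces phi Ds J : (forall i, i < size Ds -> J i <= nth 0 Ds i) ->
  \xor_(p <- chain Ds J) \xor_(q <- cfaces p) phi q =
  \xor_(i <- iota 0 (size Ds))
    ((0 < J i) && \xor_(q <- chain Ds (lower J i)) (phi q (+) phi (cneg i q))).
Proof.
elim: Ds J phi => [|D Ds IH] J phi leJ; first by rewrite /= big_cons !big_nil.
rewrite chain_cons xor_lfaces_prod [iota _ _]/= big_cons; congr (_ (+) _).
  rewrite chain_cons [\xor_(q <- flatten _) _]big_allpairs_dep.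
  rewrite (@eq_chain _ (lower J 0 \o S) (J \o S)); last by move=> i _; rewrite /lower /= subn0.
  rewrite [in RHS]exchange_big big_distrr; apply: eq_bigr => l _.
  rewrite (xor_padded_hemi_faces L (fun a => phi (a :: l)) (leJ 0 isT)).
  by rewrite /lower eqxx subn1.
rewrite -[1]addn0 iotaDl big_map.
under eq_bigr => a _ do rewrite (IH _ (fun l' => phi (a :: l')) (fun i => leJ i.+1)).
rewrite exchange_big; apply: eq_bigr => i _.
rewrite -big_distrr chain_cons [\xor_(q <- flatten _) _]big_allpairs_dep; congr (_ && _).
rewrite /lower /= subn0; apply: eq_bigr => r _.
by rewrite (@eq_chain _ _ (lower (J \o S) i)).
Qed.

(** In dimension 0 a hemisphere is the single vertex [top], so the chain has exactly one cell. *)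
Lemma xor_chain0 Ds J : (forall i, i < size Ds -> J i = 0) ->
  \xor_(p <- chain Ds J) true.
Proof.
elim: Ds J => [|D Ds IH] J J0; first by rewrite big_cons big_nil.
rewrite chain_cons [\xor_(q <- flatten _) _]big_allpairs_dep J0 //=.
rewrite (IH (J \o S)) => [|i]; last exact: (J0 i.+1).
rewrite /padded_hemi big_map (xor_hemi _ (fun=> true)) big_cons big_nil /=.
by rewrite big1 // => x _; rewrite big_nil.
Qed.

Definition surface_row D (r : seq int) :=
  [&& size r == D.+1, all (fun x => `|x| <= 2 * L) r & has (fun x => `|x| == 2 * L) r].

Definition surface_cell Ds p := all2 surface_row Ds p.

(** A coordinate of absolute value [2 * L] is even, hence a vertex in its direction, and no facet
    changes it; an odd coordinate is strictly smaller, so moving it by 1 stays in range. *)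
Lemma surface_row_faces D r q : surface_row D r -> q \in rfaces r -> surface_row D q.
Proof.
rewrite /surface_row => /and3P[/eqP <-].
elim: r q => [//|x r IH] q; rewrite [all _ _]/= [has _ _]/= => /andP[x2 ar] hr.
rewrite mem_cat => /orP[] /mapP[y yx ->] {q} /=.
  move: yx hr; rewrite /ifaces; case: ifP => ox; rewrite // !inE.
  rewrite eqSS ar eqxx => yx /orP[|->]; first by lia.
  by rewrite orbT andbT; case/orP: yx => /eqP ->; lia.
rewrite x2 /= eqSS; case/orP: hr => [hx|hr].
  rewrite hx /= andbT.
  elim: r y ar yx {IH} => [//|z r IH] y /= /andP[z2 ar].
  rewrite mem_cat => /orP[] /mapP[t tz ->] /=; rewrite eqSS ?z2 /=; last exact: IH.
  rewrite ar eqxx andbT; move: tz; rewrite /ifaces; case: ifP => // oz.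
  by rewrite !inE => /orP[] /eqP ->; lia.
by have /and3P[-> -> ->] := IH _ ar hr yx; rewrite orbT.
Qed.

Lemma surface_cell_faces Ds p q : surface_cell Ds p -> q \in cfaces p -> surface_cell Ds q.
Proof.
elim: Ds p q => [|D Ds IH] [|r p] q //=; rewrite mem_cat => /andP[gr gp].
case/orP=> /mapP[y yx ->] /=; first by rewrite gp (surface_row_faces gr).
by rewrite gr (IH p).
Qed.

Lemma mem_ihalf x : x \in ihalf L -> `|x| <= 2 * L.
Proof. by case/mapP=> k; rewrite mem_iota => /andP[_ kL] ->; lia. Qed.

Lemma mem_ifull x : x \in ifull L -> `|x| <= 2 * L.
Proof.
by rewrite mem_cat => /orP[/mem_ihalf //|/mapP[y /mem_ihalf yL ->]]; lia.
Qed.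

Lemma mem_box n r : r \in box L n -> size r = n /\ all (fun x => `|x| <= 2 * L) r.
Proof.
elim: n r => [|n IH] r; first by rewrite inE => /eqP ->.
case/allpairsPdep=> x [r' [/mem_ifull xL /IH[sr ar] ->]] /=.
by rewrite sr xL ar.
Qed.

Lemma mem_shell n r : r \in shell L n ->
  [/\ size r = n, all (fun x => `|x| <= 2 * L) r & has (fun x => `|x| == 2 * L) r].
Proof.
elim: n r => [//|n IH] r; rewrite shellS mem_cat => /orP[].
  case/allpairsPdep=> x [r' [/mem_ifull xL /IH[sr ar hr] ->]] /=.
  by rewrite sr xL ar hr orbT.
rewrite mem_cat => /orP[] /mapP[r' /mem_box[sr ar] ->] /=;
  by rewrite sr ar /top ?abszN eqxx leqnn.
Qed.

Lemma mem_padded_hemi D n r : n <= D -> r \in padded_hemi L D n -> surface_row D r.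
Proof.
move=> nD /mapP[r' r'n ->]; rewrite /surface_row size_cat size_nseq all_cat has_cat.
suff: [/\ size r' = n.+1, all (fun x => `|x| <= 2 * L) r'
        & has (fun x => `|x| == 2 * L) r'].
  by case=> -> -> ->; rewrite all_nseq addnS subnK // eqxx /= !orbT.
move: r'n; rewrite mem_cat => /orP[].
  case/allpairsPdep=> x [s [/mem_ihalf xL /mem_shell[sr ar hr] ->]] /=.
  by rewrite sr xL ar hr orbT.
by case/mapP=> s /mem_box[sr ar] -> /=; rewrite sr ar /top eqxx leqnn.
Qed.

Lemma chain_surface_cell Ds J p : (forall i, i < size Ds -> J i <= nth 0 Ds i) ->
  p \in chain Ds J -> surface_cell Ds p.
Proof.
elim: Ds J p => [|D Ds IH] J p leJ; first by rewrite inE => /eqP ->.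
case/allpairsPdep=> r [p' [rJ p'J ->]] /=; rewrite (mem_padded_hemi (leJ 0 isT)) //=.
by apply: IH p'J => i; apply: (leJ i.+1).
Qed.

Definition entry (p : seq (seq int)) i j : int := nth 0%R (nth [::] p i) j.

Lemma entry_faces p q i j : q \in cfaces p -> absz (entry p i j - entry q i j)%R <= 1.
Proof.
rewrite /entry; elim: p q i => [//|r p IH] q i /=.
rewrite mem_cat => /orP[] /mapP[q' q'r ->]; case: i => [|i] /=;
  rewrite ?subrr //; last exact: IH.
elim: r q' j q'r {IH} => [//|x r IH] q' j /=.
rewrite mem_cat => /orP[] /mapP[y yr ->]; case: j => [|j] /=;
  rewrite ?subrr //; last exact: IH.
by move: yr; rewrite /ifaces; case: ifP => // _; rewrite !inE => /orP[]/eqP ->; lia.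
Qed.

Definition close_cells k p q := forall i j, absz (entry p i j - entry q i j)%R <= k.

(** * Evaluation of the cup product of the equations *)

Section Flagged.
Variables (E : eqType) (s : E -> seq (seq int) -> bool) (chi : E -> nat -> bool).
Variable Ds : seq nat.

(* Each equation has a pivot row j, the only row of positive dimension on which
   its character is nontrivial; the characteristic class of the equation then
   acts on the product of projective spaces of dimensions J as the hyperplane
   class of the j-th factor, and cutting with it lowers J j by one. *)
Fixpoint reduces (J : nat -> nat) (es : seq E) (J' : nat -> nat) : Prop :=
  if es is e :: es' then
    exists j, [/\ j < size Ds, 0 < J j, chi e j,
      forall i, i < size Ds -> i != j -> chi e i -> J i = 0
      & reduces (lower J j) es' J']
  else forall i, i < size Ds -> J i = J' i.

Hypothesis s_odd : forall e i p, i < size Ds -> surface_cell Ds p ->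
  s e (cneg i p) = s e p (+) chi e i.

Let cfaces_even : faces_even cfaces := lfaces_even (lfaces_even ifaces_even).
Let cfaces_closed : faces_closed cfaces := lfaces_closed (lfaces_closed ifaces_closed).

(** Both ends of a step of the flag pick up the same [chi e i], which cancels in the sign change. *)
Lemma flags_cneg es i p : i < size Ds -> surface_cell Ds p ->
  flags cfaces s es (cneg i p) = flags cfaces s es p.
Proof.
elim: es p => [//|e es IH] p iD gp /=.
rewrite xor_cfaces_cneg; apply: eq_big_seq => q qp.
have gq := surface_cell_faces gp qp.
by rewrite !s_odd // IH // addbACA addbb addbF.
Qed.

(** Stokes' formula moves the sum to the boundary, where row [i] appears as an antipodal double. By
    equivariance the two halves add up to [chi e i] times the sum over one of them, and only the
    pivot row has both a nontrivial character and a boundary. *)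
Lemma xor_flags_chain e es J j : (forall i, i < size Ds -> J i <= nth 0 Ds i) ->
  j < size Ds -> 0 < J j -> chi e j ->
  (forall i, i < size Ds -> i != j -> chi e i -> J i = 0) ->
  \xor_(p <- chain Ds J) flags cfaces s (e :: es) p =
  \xor_(p <- chain Ds (lower J j)) flags cfaces s es p.
Proof.
move=> leJ jD Jj ej eJ.
under eq_bigr do rewrite (flags_cons s cfaces_even cfaces_closed).
rewrite xor_chain_faces // (bigD1_seq j) ?iota_uniq ?mem_iota //=.
have ltdec i k : k < size Ds -> lower J i k <= nth 0 Ds k.
  by move=> kD; apply: leq_trans (leJ _ kD); exact: leq_subr.
have step i : i < size Ds ->
  \xor_(q <- chain Ds (lower J i)) ((s e q && flags cfaces s es q) (+)
     (s e (cneg i q) && flags cfaces s es (cneg i q))) =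
  chi e i && \xor_(q <- chain Ds (lower J i)) flags cfaces s es q.
  move=> iD; rewrite big_distrr; apply: eq_big_seq => q qi.
  have gq : surface_cell Ds q by apply: chain_surface_cell qi => k; exact: ltdec.
  rewrite s_odd // flags_cneg // -andb_addl.
  by case: (s e q); case: (chi e i).
rewrite step // Jj ej /= [X in _ (+) X]big1_seq ?addbF // => i /andP[ij].
rewrite mem_iota => /= iD; rewrite step //.
by case ei: (chi e i); rewrite ?andbF // eJ.
Qed.

Lemma xor_flags_reduces es J J' : (forall i, i < size Ds -> J i <= nth 0 Ds i) ->
  (forall i, i < size Ds -> J' i = 0) -> reduces J es J' ->
  \xor_(p <- chain Ds J) flags cfaces s es p.
Proof.
elim: es J => [|e es IH] J leJ J'0 /=.
  by move=> eqJ; apply: xor_chain0 => i iD; rewrite eqJ ?J'0.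
case=> j [jD Jj ej eJ red].
rewrite (xor_flags_chain es leJ jD Jj ej eJ); apply: IH => // i iD.
by apply: leq_trans (leJ _ iD); exact: leq_subr.
Qed.

(** A flag makes [size es] descents, each moving an entry by at most 1, so it stays close to [p];
    there the factor of [e] has no sign change. *)
Lemma flags_const es p e c : surface_cell Ds p -> e \in es ->
  (forall q, surface_cell Ds q -> close_cells (size es) p q -> s e q = c) ->
  flags cfaces s es p = false.
Proof.
elim: es p => [//|e' es IH] p gp; rewrite inE => ees sc /=.
apply: big1_seq => q /andP[_ qp].
have gq := surface_cell_faces gp qp.
have npq := entry_faces _ _ qp.
case/orP: ees => [/eqP ee|ees].
  rewrite -ee !sc ?addbb // => i j; last by rewrite subrr.
  by apply: leq_trans (npq i j) _.
rewrite (IH q) ?andbF // => q' gq' nq'; apply: sc => // i j.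
have := npq i j; have := nq' i j; rewrite /=; lia.
Qed.

Theorem flag_exists es : reduces (nth 0 Ds) es (fun=> 0) ->
  exists2 p, surface_cell Ds p & forall e c, e \in es ->
    ~ forall q, surface_cell Ds q -> close_cells (size es) p q -> s e q = c.
Proof.
move=> red.
have ch : \xor_(p <- chain Ds (nth 0 Ds)) flags cfaces s es p.
  exact: xor_flags_reduces red.
have [p pc fp] : exists2 p, p \in chain Ds (nth 0 Ds) & flags cfaces s es p.
  apply/hasP; apply: contraT => /hasPn nf; move: ch; rewrite big1_seq // => p.
  by case/andP=> _ /nf /negbTE.
have gp : surface_cell Ds p by apply: chain_surface_cell pc.
exists p => // e c ees sc.
by rewrite (flags_const gp ees sc) in fp.
Qed.

End Flagged.
End Chain.

(** * The characters of the equations *)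

Section Reduces.
Variables (E : eqType) (chi : E -> nat -> bool) (Ds : seq nat).

Lemma eq_reduces J1 J2 es J' : (forall i, i < size Ds -> J1 i = J2 i) ->
  reduces chi Ds J1 es J' -> reduces chi Ds J2 es J'.
Proof.
elim: es J1 J2 => [|e es IH] J1 J2 eqJ /=; first by move=> eq1 i iD; rewrite -eqJ ?eq1.
case=> j [jD J1j ej eJ red]; exists j; split; rewrite -?eqJ //.
  by move=> i iD ij ei; rewrite -eqJ ?eJ.
by apply: IH red => i iD; rewrite /lower eqJ.
Qed.

Lemma reduces_cat J es J' es' J'' : reduces chi Ds J es J' ->
  reduces chi Ds J' es' J'' -> reduces chi Ds J (es ++ es') J''.
Proof.
move=> red red'; elim: es J red => [|e es IH] J /=.
  by move=> eqJ; apply: eq_reduces red' => i iD; rewrite eqJ.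
by case=> j [jD Jj ej eJ red]; exists j; split=> //; exact: IH.
Qed.

(** Dimensions only decrease, so rows that vanish at the start still vanish at each later step; for
    a batch of equations it remains to count the pivots in each row. *)
Lemma reduces_pivots (pv : E -> nat) J es J' :
  (forall e, e \in es -> [/\ pv e < size Ds, chi e (pv e) &
     forall i, i < size Ds -> i != pv e -> chi e i -> J i = 0]) ->
  (forall l, l < size Ds -> count (fun e => pv e == l) es <= J l) ->
  (forall l, l < size Ds -> J' l = J l - count (fun e => pv e == l) es) ->
  reduces chi Ds J es J'.
Proof.
elim: es J => [|e es IH] J pves cJ eqJ' /=; first by move=> i iD; rewrite eqJ' // subn0.
have [eD ee eJ] := pves e (mem_head _ _); exists (pv e); split=> //.
  by have := cJ _ eD; rewrite /= eqxx; lia.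
apply: IH => [e' e'es|l lD|l lD].
- have e'in : e' \in e :: es by rewrite inE e'es orbT.
  have [e'D ee' e'J] := pves e' e'in; split=> // i iD ie' ei.
  by rewrite /lower e'J.
- by have := cJ _ lD; rewrite /lower /= eq_sym; lia.
- by rewrite eqJ' // /lower /= eq_sym subnDA.
Qed.

End Reduces.

Section Equations.
Variables (d n : nat).
Hypothesis nd : n <= d.

Definition coord_equation := {i : 'I_n.+1 & 'I_(d - i)}.
Definition equation := (coord_equation + 'I_n * 'I_n)%type.

Definition coord_eqn (i : 'I_n.+1) (c : 'I_(d - i)) : equation :=
  inl (Tagged (fun i : 'I_n.+1 => 'I_(d - i)) c).

Definition equation_char (e : equation) (l : nat) : bool :=
  match e with
  | inl (existT i c) => (l == i) || [&& l == 0, i != 0 :> nat & c == 0 :> nat]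
  | inr (i, j) => (l == i.+1) (+) (l == j.+1)
  end.

Definition equation_pivot (e : equation) : nat :=
  match e with inl (existT i _) => i | inr (_, j) => j.+1 end.

Definition coord_equations (i : 'I_n.+1) : seq equation :=
  [seq coord_eqn c | c <- enum 'I_(d - i)].

Definition orth_equations (i : 'I_n) : seq equation :=
  [seq inr (i, j) | j : 'I_n <- enum 'I_n & i < j].

(** The order is that of the elimination: the coordinate equations of a row use it up, and then its
    orthogonality relations have the later row as pivot. *)
Definition equations : seq equation :=
  coord_equations ord0 ++
  flatten [seq coord_equations (lift ord0 i) ++ orth_equations i | i <- enum 'I_n].

Lemma coord_eqn_in (i : 'I_n.+1) (c : 'I_(d - i)) : coord_eqn c \in equations.
Proof.
have cin (i' : 'I_n.+1) (c' : 'I_(d - i')) : coord_eqn c' \in coord_equations i'.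
  by apply: map_f; rewrite mem_enum.
rewrite mem_cat; case: (unliftP ord0 i) c => [i' ->|->] c; last by rewrite cin.
apply/orP; right; apply/flatten_mapP; exists i'; first by rewrite mem_enum.
by rewrite mem_cat cin.
Qed.

Lemma orth_eqn_in (i j : 'I_n) : i < j -> (inr (i, j) : equation) \in equations.
Proof.
move=> ij; rewrite mem_cat; apply/orP; right; apply/flatten_mapP; exists i.
  by rewrite mem_enum.
by rewrite mem_cat; apply/orP; right; apply: map_f; rewrite mem_filter ij mem_enum.
Qed.

Definition dims : seq nat := d :: nseq n d.-1.

Lemma size_dims : size dims = n.+1. Proof. by rewrite /= size_nseq. Qed.

(* The dimensions left after the equations of the rows 0, ..., t: those rows are
   used up, and each later row has lost one dimension for every earlier row but
   row 0, to which it is made orthogonal. *)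
Let stage t l := if l <= t then 0 else d - t.+1.

Lemma count_coord_equations (i : 'I_n.+1) l :
  count (fun e => equation_pivot e == l) (coord_equations i) = if l == i then d - i else 0.
Proof.
rewrite count_map; case: eqP => [->|li].
  by rewrite (@eq_count _ _ predT) ?count_predT ?size_enum_ord // => c /=; rewrite eqxx.
rewrite (@eq_count _ _ pred0) ?count_pred0 // => c /=.
by apply/eqP => il; apply: li.
Qed.

Lemma count_orth_equations (i : 'I_n) l : l < n.+1 ->
  count (fun e => equation_pivot e == l) (orth_equations i) = (i.+1 < l).
Proof.
case: l => [|l] ln; rewrite count_map.
  by rewrite (@eq_count _ _ pred0) ?count_pred0.
pose j : 'I_n := Ordinal (ln : l < n).
rewrite count_filter (@eq_count _ _ (fun k => (k == j) && (i < l))).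
  rewrite ltnS; case: (i < l).
    rewrite (@eq_count _ _ (pred1 j)); last by move=> k; rewrite /= andbT.
    by rewrite count_uniq_mem ?enum_uniq // mem_enum.
  by rewrite (@eq_count _ _ pred0) ?count_pred0 // => k /=; rewrite andbF.
move=> k /=; rewrite eqSS -[k == j]/(k == l :> nat).
by case: eqP => // ->.
Qed.

Lemma reduces_stage (i : 'I_n) :
  reduces equation_char dims (stage i) (coord_equations (lift ord0 i) ++ orth_equations i)
    (stage i.+1).
Proof.
have im := ltn_ord i.
(* Intermediate dimensions: row [i.+1] is used up, but the later rows are not yet made orthogonal to
   it. *)
apply: (@reduces_cat _ _ _ _ _ (fun l => if l <= i.+1 then 0 else d - i.+1)).
  apply: (@reduces_pivots _ _ _ equation_pivot) => [_ /mapP[c _ ->]|l|l];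
      rewrite size_dims.
  (* A first coordinate also changes sign with row 0, whose dimension is already 0. *)
  - split=> /=; rewrite ?eqxx // ?size_dims ?ltnS // => l _ /negbTE -> /=.
    by rewrite /stage => /andP[/eqP -> _].
  - rewrite count_coord_equations /stage /= /bump add1n.
    by case: ifP => // /eqP ->; rewrite ltnn.
  - by rewrite count_coord_equations /stage /= /bump add1n => ln;
      case: eqP => li; case: leqP => ?; case: leqP => ?; lia.
apply: (@reduces_pivots _ _ _ equation_pivot) => [_ /mapP[j + ->]|l|l];
    rewrite size_dims.
- rewrite mem_filter => /andP[ij _]; have := ltn_ord j.
  split=> /=; rewrite ?eqxx ?size_dims //; first by lia.
  by move=> l _ /negbTE ->; rewrite addbF => /eqP ->; rewrite leqnn.
- by move=> ln; rewrite count_orth_equations //; case: leqP => ?; lia.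
- by move=> ln; rewrite count_orth_equations // /stage; case: leqP => ?; lia.
Qed.

Lemma reduces_equations : reduces equation_char dims (nth 0 dims) equations (fun=> 0).
Proof.
have nth_dims l : l < n.+1 -> nth 0 dims l = if l == 0 then d else d.-1.
  by case: l => //= l ln; rewrite nth_nseq ifT.
apply: (@reduces_cat _ _ _ _ _ (stage 0)).
  apply: (@reduces_pivots _ _ _ equation_pivot) => [_ /mapP[c _ ->]|l|l];
      rewrite size_dims.
  - by split=> //= l _ /negbTE ->; rewrite andbF.
  - by move=> ln; rewrite nth_dims // count_coord_equations subn0; case: eqP.
  - by move=> ln; rewrite nth_dims // count_coord_equations /stage /= leqn0; case: eqP; lia.
have stages s t : map val s = iota t (size s) ->
  reduces equation_char dims (stage t)
    (flatten [seq coord_equations (lift ord0 i) ++ orth_equations i | i <- s])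
    (stage (t + size s)).
  elim: s t => [|i s IH] t; first by move=> _ l _; rewrite addn0.
  move=> [it /IH red]; rewrite /= addnS -addSn; apply: reduces_cat red.
  by rewrite -it; exact: reduces_stage.
have : reduces equation_char dims (stage 0)
    (flatten [seq coord_equations (lift ord0 i) ++ orth_equations i | i <- enum 'I_n])
    (stage n).
  by have := stages (enum 'I_n) 0; rewrite size_enum_ord add0n; apply; exact: val_enum_ord.
move=> red; rewrite -[flatten _]cats0; apply: reduces_cat red _ => l.
by rewrite size_dims ltnS /stage => ->.
Qed.

End Equations.

Section RowSign.

(** The first nonzero entry decides: an odd sign on nonzero rows, used to break ties where an
    equation vanishes. *)
Fixpoint row_neg (r : seq int) : bool :=
  if r is x :: r' then (if x == 0%R then row_neg r' else (x < 0)%R) else false.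

Lemma row_neg_rneg r : has (fun x => x != 0%R) r -> row_neg (rneg r) = ~~ row_neg r.
Proof.
elim: r => [//|x r IH] /=; rewrite oppr_eq0; case: eqP => [_|/eqP x0 _]; first exact: IH.
by rewrite oppr_lt0 -leNgt le_eqVlt eq_sym (negbTE x0).
Qed.

Lemma nth_cneg i p k : nth [::] (cneg i p) k =
  if k == i then rneg (nth [::] p k) else nth [::] p k.
Proof.
elim: p i k => [|r p IH] i k; first by case: i => [|i]; rewrite /= nth_nil; case: eqP.
by case: i k => [|i] [|k] //=; rewrite IH.
Qed.

Lemma entry_cneg i p k j :
  entry (cneg i p) k j = if k == i then (- entry p k j)%R else entry p k j.
Proof.
rewrite /entry nth_cneg; case: eqP => // _.
elim: (nth _ _ _) j => [|x r IH] [|j] //=; rewrite ?nth_nil ?oppr0 //.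
Qed.

Variables (L : nat) (Ds : seq nat).
Hypothesis L0 : 0 < L.

Lemma surface_cell_nth p i : surface_cell L Ds p -> i < size Ds ->
  surface_row L (nth 0 Ds i) (nth [::] p i).
Proof.
elim: Ds p i => [//|D Ds' IH] [|r p] [|i] //= /andP[gr gp] iD //.
exact: IH.
Qed.

Lemma row_neg_cneg p i k : surface_cell L Ds p -> i < size Ds ->
  row_neg (nth [::] (cneg i p) k) = row_neg (nth [::] p k) (+) (k == i).
Proof.
move=> gp iD; rewrite nth_cneg; case: eqP => [->|_]; last by rewrite addbF.
rewrite addbT row_neg_rneg //; have /and3P[_ _] := surface_cell_nth gp iD.
by apply: sub_has => x /eqP xL; apply/eqP => x0; move: xL; rewrite x0; lia.
Qed.

End RowSign.

Local Open Scope ring_scope.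
Local Open Scope classical_set_scope.

(** * Sign changes at a common point *)

Lemma cvg_mx (R : realType) m n T (F : set_system T) {FF : Filter F}
    (f : T -> 'M[R]_(m, n)) (w : 'M[R]_(m, n)) :
  (forall i j, f x i j @[x --> F] --> w i j) -> f @ F --> w.
Proof.
move=> fw; apply/cvgrPdist_lt => e e0.
have : \forall x \near F, forall i j, `|w i j - f x i j| < e.
  apply: filter_forall => i; apply: filter_forall => j.
  by move/cvgrPdist_lt: (fw i j); apply.
apply: filterS => x wx.
suff : ball w e (f x) by rewrite -ball_normE.
by split.
Qed.

Lemma compact_mx_cube (R : realType) m n :
  compact [set w : 'M[R]_(m, n) | forall i j, `|w i j| <= 1].
Proof.
have cr : compact [set v : 'rV[R]_(m * n) | forall k, (`[-1, 1]%classic : set R) (v ord0 k)].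
  exact: (@rV_compact R _ (fun=> `[-1, 1]%classic) (fun=> @segment_compact R _ _)).
have := @continuous_compact _ _ (vec_mx : 'rV[R]_(m * n) -> 'M[R]_(m, n)) _ _ cr.
rewrite (_ : [set _ | _] = [set vec_mx x | x in [set v : 'rV[R]_(m * n) |
   forall k, (`[-1, 1]%classic : set R) (v ord0 k)]]).
  apply; apply: continuous_subspaceT => v.
  apply: (@cvg_mx _ _ _ _ _ (nbhs_filter v)) => i j.
  under eq_fun do rewrite mxE.
  by rewrite mxE; exact: coord_continuous.
apply/seteqP; split=> [w w1|_ [v v1 <-]] /=.
  exists (mxvec w); last by rewrite mxvecK.
  move=> k /=; case/mxvec_indexP: k => i j.
  by rewrite mxvecE in_itv /= -ler_norml.
by move=> i j; rewrite mxE ler_norml; have := v1 (mxvec_index i j); rewrite /= in_itv.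
Qed.

Definition flip (R : realType) m n (i : 'I_m) (w : 'M[R]_(m, n)) : 'M[R]_(m, n) :=
  \matrix_(k, j) (if k == i then - w k j else w k j).

Section Index.
Variables (R : realType) (m N : nat) (E : eqType).
Variables (chi : E -> nat -> bool) (H : E -> 'M[R]_(m, N) -> R).
Variables (Ds : seq nat) (es : seq E).
Hypotheses (szD : size Ds = m) (DN : forall i, (i < m)%N -> (nth 0 Ds i < N)%N).
Hypothesis H_odd : forall e (i : 'I_m) w, H e (flip i w) = (-1) ^+ chi e i * H e w.
Hypothesis red : reduces chi Ds (nth 0%N Ds) es (fun=> 0%N).

(** The scale sends cells of parameter [L.+1] to the surfaces of unit cubes. Rows shorter than [N]
    are padded with the default 0 of [entry]. *)
Let grid L p : 'M[R]_(m, N) := \matrix_(i, j) ((entry p i j)%:~R / (2 * L.+1)%:R).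

(* Where an equation vanishes at a grid point, its sign is chosen so as to respect
   equivariance. *)
Let sgn_grid L e p : bool :=
  if H e (grid L p) == 0
  then \xor_(k <- iota 0 m) (chi e k && row_neg (nth [::] p k))
  else H e (grid L p) < 0.

Lemma grid_cneg L (i : 'I_m) p : grid L (cneg i p) = flip i (grid L p).
Proof.
apply/matrixP => k j; rewrite !mxE entry_cneg (_ : (k == i :> nat) = (k == i)) //.
by case: eqP => // _; rewrite rmorphN mulNr.
Qed.

Lemma sgn_grid_odd L e i p : (i < size Ds)%N -> surface_cell L.+1 Ds p ->
  sgn_grid L e (cneg i p) = sgn_grid L e p (+) chi e i.
Proof.
move=> iD gp; have im : (i < m)%N by rewrite -szD.
rewrite /sgn_grid (grid_cneg L (Ordinal im)) H_odd /=.
rewrite mulf_eq0 signr_eq0 /=; case: eqP => [_|/eqP H0].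
  under eq_bigr do rewrite (row_neg_cneg (ltn0Sn L) _ gp iD) andb_addr.
  rewrite big_split /=; congr (_ (+) _).
  rewrite (bigD1_seq i) ?iota_uniq ?mem_iota //= eqxx andbT big1_seq ?addbF //.
  by move=> k /andP[/negbTE -> _]; rewrite andbF.
case: (chi e i); rewrite ?addbF ?expr0 ?mul1r // expr1 mulN1r oppr_lt0 addbT.
by rewrite -leNgt le_eqVlt eq_sym (negbTE H0).
Qed.

Lemma grid_close L k p q i j : close_cells k p q ->
  `|grid L p i j - grid L q i j| <= k%:R / (2 * L.+1)%:R.
Proof.
move=> /(_ i j) pq; rewrite !mxE -mulrBl normrM normfV normr_nat ler_pM2r.
  by rewrite -intrB -intr_norm pmulrn -abszE ler_int.
by rewrite invr_gt0 ltr0n.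
Qed.

(** The point is a cluster point of flagged cells at finer and finer scales. Since [H e] may be
    discontinuous, the conclusion excludes a persistent strict sign near [w] instead of asserting a
    zero at [w]. *)
Theorem sign_change_exists : exists w : 'M[R]_(m, N),
  (forall i : 'I_m, exists2 j : 'I_N, (j <= nth 0 Ds i)%N & w i j != 0) /\
  forall e, e \in es -> ~ (\forall w' \near w, 0 < H e w') /\
                        ~ (\forall w' \near w, H e w' < 0).
Proof.
pose flagged L p := surface_cell L.+1 Ds p /\ forall e c, e \in es ->
    ~ forall q, surface_cell L.+1 Ds q -> close_cells (size es) p q -> sgn_grid L e q = c.
have /choice[p pP] : forall L, exists p, flagged L p.
  move=> L; have [p gp cp] := @flag_exists L.+1 E (sgn_grid L) chi Ds
    (fun e i q iD gq => sgn_grid_odd e iD gq) es red.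
  by exists p.
pose x L := grid L (p L).
have xK : (x @ \oo) [set w | forall i j, `|w i j| <= 1].
  exists 0%N => // L _ i j; rewrite /x mxE normrM normfV normr_nat.
  rewrite ler_pdivrMr ?ltr0n // mul1r -intr_norm pmulrn -abszE ler_int.
  rewrite /entry; have [jD|jD] := ltnP j (size (nth [::] (p L) i)); last first.
    by rewrite nth_default.
  have iD : (i < size Ds)%N by rewrite szD.
  have /and3P[_ /all_nthP a2 _] := surface_cell_nth (pP L).1 iD.
  exact: (a2 0).
have [w [_ clw]] := compact_mx_cube _ xK.
have clx M e : 0 < e -> exists2 L, (M <= L)%N & ball w e (x L).
  move=> e0; have [|_ [[L ML <-] wx]] :=
    clw [set x L | L in [set L | (M <= L)%N]] (ball w e) _ (nbhsx_ballx _ _ e0).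
    by exists M => // L ML; exists L.
  by exists L.
exists w; split.
  move=> i; apply: contrapT => w0.
  (* Each grid row has an entry of absolute value 1, which cannot be within distance less than 1 of
     a zero entry of [w]. *)
  have [L _ [_ /(_ i) wx]] := clx 0%N 1 ltr01.
  have iD : (i < size Ds)%N by rewrite szD.
  have /and3P[/eqP sr _ /(has_nthP 0)[j jr /eqP rj]] := surface_cell_nth (pP L).1 iD.
  have jN : (j < N)%N by rewrite sr in jr; have := DN (ltn_ord i); lia.
  have wj : w i (Ordinal jN) = 0.
    apply: contrapT => /eqP wj; apply: w0; exists (Ordinal jN) => //=.
    by rewrite -ltnS -sr.
  have := wx (Ordinal jN); rewrite /ball /= wj sub0r normrN /x mxE.
  rewrite normrM normfV normr_nat -intr_norm -abszE /entry rj.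
  by rewrite divff ?ltxx // pnatr_eq0.
move=> e ees.
have far (P : R -> Prop) c : (forall L q, P (H e (grid L q)) -> sgn_grid L e q = c) ->
    ~ (\forall w' \near w, P (H e w')).
  move=> Pc /nbhs_ballP[d /= d0 wd].
  (* Past [M], cells close to the flagged one lie within [d / 2] of [x L], which is itself within
     [d / 2] of [w]. *)
  have [M _ Md] := nbhs_infty_gtr ((size es)%:R / d).
  have d2 : 0 < d / 2 by lra.
  have [L ML wx] := clx M _ d2.
  apply: (pP L).2 ees _ => q gq pq; apply: Pc; apply: wd.
  have {}Md := Md L ML.
  split=> // i j; rewrite /ball /=.
  have := grid_close L i j pq; case: wx => _ /(_ i j); rewrite /ball /=.
  have kd : (size es)%:R / (2 * L.+1)%:R < d / 2.
    rewrite natrM invfM mulrCA [d / 2]mulrC ltr_pM2l ?invr_gt0 ?ltr0n // ltr_pdivrMr ?ltr0n //.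
    move: Md; rewrite ltr_pdivrMr // => Md; apply: lt_le_trans Md _.
    by rewrite mulrC ler_pM2l // ler_nat.
  move=> wx xq; rewrite (_ : w i j - _ = (w i j - x L i j) + (x L i j - grid L q i j)); last by lra.
  have := le_lt_trans xq kd => {}xq.
  apply: le_lt_trans (ler_normD _ _) _; rewrite (splitr d).
  exact: ltrD.
split; [apply: (far (fun y => 0 < y) false)|apply: (far (fun y => y < 0) true)] => L q;
  rewrite /sgn_grid.
  by move=> Hq; rewrite gt_eqF // ltNge ltW.
by move=> Hq; rewrite lt_eqF.
Qed.

End Index.

(** * Signs from comparing distances to two sets *)

Lemma near_cvg (T U : topologicalType) (g : T -> U) (x : T) (A : set U) :
  g y @[y --> x] --> g x -> nbhs (g x) A -> \forall y \near x, A (g y).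
Proof. by move=> gx /gx. Qed.

Section Closer.
Variables (R : realType) (T : pseudoMetricType R).

(* B is farther from y than A is; phrased with balls so that empty A or B need no
   convention. *)
Definition closer (A B : set T) (y : T) : Prop :=
  exists2 r : R, exists2 a, A a & ball y r a & forall b, B b -> ~ ball y r b.

Lemma closer_asym A B y : closer A B y -> closer B A y -> False.
Proof.
move=> [r [a Aa ya] Br] [s [b Bb yb] As].
have [rs|sr] := leP r s; first by apply: (As a) => //; exact: le_ball ya.
by apply: (Br b) => //; apply: le_ball yb; exact: ltW.
Qed.

Lemma closer_iso (g : T -> T) (A B A' B' : set T) y : involutive g ->
  (forall r a b, ball a r b -> ball (g a) r (g b)) ->
  (forall a, A a -> A' (g a)) -> (forall b, B' b -> B (g b)) ->
  closer A B y -> closer A' B' (g y).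
Proof.
move=> gK gball AA' BB' [r [a Aa ya] Br]; exists r.
  by exists (g a); [exact: AA'|exact: gball].
by move=> b /BB' Bgb /gball; rewrite gK; exact: Br.
Qed.

Lemma closer_near (A B : set T) (y : T) (e : R) : 0 < e -> A y ->
  (forall b, B b -> ~ ball y e b) -> nbhs y (closer A B).
Proof.
move=> e0 Ay Be; have e2 : 0 < e / 2 by rewrite divr_gt0.
have : \forall z \near y, ball y (e / 2) z by exact: nbhsx_ballx.
apply: filterS => z yz; exists (e / 2).
  by exists y => //; exact: ball_sym.
by move=> b Bb zb; apply: (Be b) => //; exact: ball_split yz zb.
Qed.

End Closer.

Section Side.
Variable R : realType.

Definition side (P Q : Prop) : R := if `[< P >] then 1 else if `[< Q >] then -1 else 0.

Lemma eq_side P P' Q Q' : (P <-> P') -> (Q <-> Q') -> side P Q = side P' Q'.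
Proof. by move=> /asbool_equiv_eq eP /asbool_equiv_eq eQ; rewrite /side eP eQ. Qed.

Lemma side_swap P Q : (P -> Q -> False) -> side Q P = - side P Q.
Proof.
move=> PQ; rewrite /side; case: asboolP => q; case: asboolP => p; rewrite ?opprK ?oppr0 //.
by case: (PQ p q).
Qed.

Lemma side_gt0 (P Q : Prop) : P -> 0 < side P Q.
Proof. by move=> p; rewrite /side asboolT // ltr01. Qed.

End Side.

(** * Orthonormal frames *)

Section Frames.
Variables (R : realType) (d n : nat).
Hypothesis nd : (n <= d)%N.
Local Notation P := ('rV[R]_d.+1 * 'M[R]_(n, d))%type.
Local Notation W := ('M[R]_(n.+1, d.+1)).

Let X : set P := [set p | sphere p.1 /\ stiefel p.2].

Definition first_norm (w : W) : R := Num.sqrt (\sum_(j < d.+1) w ord0 j ^+ 2).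

(** All rows share an ambient matrix with [d.+1] columns; the vectors of R^d occupy the first [d] of
    them. *)
Definition tail (w : W) (i : 'I_n) (c : 'I_d) : R := w (lift ord0 i) (widen_ord (leqnSn d) c).

Definition tail_norm (w : W) (i : 'I_n) : R := Num.sqrt (\sum_(c < d) tail w i c ^+ 2).

Definition normalized (w : W) : P :=
  (\row_j (w ord0 j / first_norm w), \matrix_(i, c) (tail w i c / tail_norm w i)).

(** The generator m_i of G. *)
Definition refl (i : 'I_n.+1) : Zgrp n := [ffun k => k == i].

Lemma sgnE b : sgn R b = (-1) ^+ b.
Proof. by case: b. Qed.

Lemma flipE (i : 'I_n.+1) (w : W) k j : flip i w k j = sgn R (refl i k) * w k j.
Proof. by rewrite mxE ffunE sgnE mulr_sign. Qed.

Lemma tail_flip (i : 'I_n.+1) (w : W) k c :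
  tail (flip i w) k c = sgn R (refl i (lift ord0 k)) * tail w k c.
Proof. exact: flipE. Qed.

Lemma sgn_sqr b : sgn R b ^+ 2 = 1.
Proof. by rewrite sgnE sqrr_sign. Qed.

Lemma normalized_flip (i : 'I_n.+1) (w : W) :
  normalized (flip i w) = actX (refl i) (normalized w).
Proof.
rewrite /normalized /actX /=.
have -> : first_norm (flip i w) = first_norm w.
  by congr Num.sqrt; apply: eq_bigr => j _; rewrite flipE exprMn sgn_sqr mul1r.
congr (_, _).
  by apply/rowP => j; rewrite [LHS]mxE flipE !mxE mulrA.
apply/matrixP => k c; rewrite [LHS]mxE tail_flip !mxE mulrA.
congr (_ / Num.sqrt _); apply: eq_bigr => l _.
by rewrite tail_flip exprMn sgn_sqr mul1r.
Qed.

Lemma actXK (g : Zgrp n) : involutive (actX g : P -> P).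
Proof.
move=> [a V]; rewrite /actX /=; congr (_, _).
  by rewrite scalerA -expr2 sgn_sqr scale1r.
by apply/matrixP => i j; rewrite !mxE mulrA -expr2 sgn_sqr mul1r.
Qed.

Lemma actX_ball (g : Zgrp n) r (a b : P) : ball a r b -> ball (actX g a) r (actX g b).
Proof.
have sg (h : bool) (x y : R) : ball x r y -> ball (sgn R h * x) r (sgn R h * y).
  rewrite /ball /= -mulrBr normrM sgnE normr_sign mul1r //.
case: a b => [a V] [b U] [[r0 ab] [_ VU]]; split; split=> // i j; rewrite !mxE.
  by apply: sg; exact: ab.
by apply: sg; exact: VU.
Qed.

Lemma actX_frames (g : Zgrp n) p : X p -> X (actX g p).
Proof.
move=> [p1 p2]; split.
  rewrite /sphere /= -[RHS]p1; apply: eq_bigr => j _.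
  by rewrite mxE exprMn sgn_sqr mul1r.
apply/matrixP => i j; move/matrixP: p2 => /(_ i j); rewrite !mxE => p2.
under eq_bigr do rewrite !mxE mulrACA.
rewrite -mulr_sumr; move: p2; under eq_bigr do rewrite mxE.
move=> ->; case: eqP => [->|_]; last by rewrite mulr0.
by rewrite mulr1 -expr2 sgn_sqr.
Qed.

Lemma sum_sqr_gt0 (I : finType) (F : I -> R) (i : I) : F i != 0 -> 0 < \sum_i F i ^+ 2.
Proof.
move=> Fi; rewrite (bigD1 i) //= ltr_wpDr ?exprn_even_gt0 //.
by apply: sumr_ge0 => k _; exact: sqr_ge0.
Qed.

Lemma sum_normalized (I : finType) (F : I -> R) (i : I) : F i != 0 ->
  \sum_i (F i / Num.sqrt (\sum_i F i ^+ 2)) ^+ 2 = 1.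
Proof.
move=> /sum_sqr_gt0 F0; under eq_bigr do rewrite expr_div_n sqr_sqrtr ?ltW //.
by rewrite -mulr_suml divff // gt_eqF.
Qed.

Lemma cvg_sqrt_sum (I : finType) T (F : set_system T) {FF : Filter F}
    (f : I -> T -> R) (a : I -> R) :
  (forall i, f i x @[x --> F] --> a i) ->
  Num.sqrt (\sum_i f i x ^+ 2) @[x --> F] --> Num.sqrt (\sum_i a i ^+ 2).
Proof.
move=> fa; apply: (@continuous_cvg _ _ _ F FF (fun x => \sum_i f i x ^+ 2) Num.sqrt).
  exact: sqrt_continuous.
apply: cvg_big => [|i _]; first exact: add_continuous.
by rewrite expr2; apply: cvgM.
Qed.

Lemma cvg_normalized (w : W) : first_norm w != 0 -> (forall i, tail_norm w i != 0) ->
  normalized x @[x --> w] --> normalized w.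
Proof.
move=> w0 wi.
have cw i j : x i j @[x --> w] --> (w i j : R) by exact: coord_continuous.
apply: (@cvg_pair _ _ _ (nbhs w) (nbhs (normalized w).1) (nbhs (normalized w).2)
    _ _ _ (fun x => (normalized x).1) (fun x => (normalized x).2));
  apply: (@cvg_mx _ _ _ _ _ (nbhs_filter w)) => i j.
  rewrite mxE; under eq_fun do rewrite mxE.
  have fw : first_norm x @[x --> w] --> first_norm w.
    by apply: (@cvg_sqrt_sum _ _ _ (nbhs_filter w)) => l; exact: cw.
  exact: (@cvgM _ _ _ (nbhs_filter w) _ _ _ _ (cw _ _)
    (@cvgV _ _ _ (nbhs_filter w) _ _ w0 fw)).
rewrite mxE; under eq_fun do rewrite mxE.
have tw : tail_norm x i @[x --> w] --> tail_norm w i.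
  by apply: (@cvg_sqrt_sum _ _ _ (nbhs_filter w)) => l; exact: cw.
exact: (@cvgM _ _ _ (nbhs_filter w) _ _ _ _ (cw _ _)
    (@cvgV _ _ _ (nbhs_filter w) _ _ (wi i) tw)).
Qed.

Lemma normalized_frames (w : W) :
  (exists j, w ord0 j != 0) -> (forall i, exists c, tail w i c != 0) ->
  (forall i j : 'I_n, (i < j)%N -> \sum_(c < d) tail w i c * tail w j c = 0) ->
  X (normalized w).
Proof.
move=> [j wj] wt wo; split.
  rewrite /sphere /=; under eq_bigr do rewrite mxE.
  exact: (@sum_normalized _ (fun j => w ord0 j) j wj).
apply/matrixP => i k; rewrite !mxE; under eq_bigr do rewrite !mxE.
case: eqP => [<-|/eqP ik].
  have [c wc] := wt i; under eq_bigr do rewrite -expr2.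
  exact: (@sum_normalized _ (tail w i) c wc).
under eq_bigr do rewrite mulrACA.
rewrite -mulr_suml (_ : \sum_(c < d) _ = 0) ?mul0r //.
move: ik; rewrite -val_eqE neq_ltn => /orP[ik|ki]; first exact: wo.
by under eq_bigr do rewrite mulrC; exact: wo.
Qed.

(** * The equations of an equivariant map *)

Section Map.
Variable f : forall i : 'I_n.+1, P -> 'rV[R]_(d - i).
Hypothesis hcont : forall i, {within X, continuous (f i)}.
Hypothesis hequiv : forall (g : Zgrp n) p, sphere p.1 -> stiefel p.2 ->
  forall i, f i (actX g p) = actR g (f i p).

Definition half_space (s : R) (i : 'I_n.+1) (c : 'I_(d - i)) : set P :=
  [set y | X y /\ 0 <= s * f i y ord0 c].

Definition sided (s : R) (i : 'I_n.+1) (c : 'I_(d - i)) : set P :=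
  closer (half_space s c) (half_space (- s) c).

(* Only the sign of a component of f matters, and it is extended to all tuples
   of unit vectors by comparing the distances to the two half-spaces. *)
Definition equation_val (e : equation d n) (w : W) : R :=
  match e with
  | inl (existT i c) =>
    side R (sided 1 c (normalized w)) (sided (-1) c (normalized w))
  | inr (i, j) => \sum_(c < d) tail w i c * tail w j c
  end.

Lemma f_refl (k : 'I_n.+1) (i : 'I_n.+1) (c : 'I_(d - i)) y : X y ->
  f i (actX (refl k) y) ord0 c = (-1) ^+ equation_char (coord_eqn c) k * f i y ord0 c.
Proof.
move=> [y1 y2]; rewrite hequiv // mxE !ffunE !sgnE.
have kE (l : 'I_n.+1) : (l == k) = (k == l :> nat) by rewrite eq_sym.
rewrite !kE /= -[i == 0%N :> nat]/(i == ord0).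
case: (boolP (i == ord0)) => [/eqP i0|i0] /=.
  have -> : (k == i :> nat) = (k == 0%N :> nat) by rewrite i0.
  by rewrite andbF orbF.
(* As [i] is nonzero, the two conditions exclude each other, so the product of the two signs in
   [actR] matches the disjunction in [equation_char]. *)
have : ~~ ((k == i :> nat) && (k == 0%N :> nat)).
  apply: contra i0 => /andP[/eqP ki /eqP k0].
  by apply/eqP/val_inj; rewrite /= -ki k0.
by case: (k == i :> nat); case: (k == 0%N :> nat); case: (c == 0%N :> nat) => //= _;
  rewrite ?expr0 ?expr1 ?mulr1 ?mul1r.
Qed.

Lemma half_space_refl (k : 'I_n.+1) s (i : 'I_n.+1) (c : 'I_(d - i)) y :
  half_space s c y ->
  half_space ((-1) ^+ equation_char (coord_eqn c) k * s) c (actX (refl k) y).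
Proof.
move=> [Xy sy]; split; first exact: actX_frames.
by rewrite f_refl // mulrACA -expr2 sqrr_sign mul1r.
Qed.

Lemma sided_flip (k : 'I_n.+1) s (i : 'I_n.+1) (c : 'I_(d - i)) w :
  sided s c (normalized w) ->
  sided ((-1) ^+ equation_char (coord_eqn c) k * s) c (normalized (flip k w)).
Proof.
rewrite normalized_flip; apply: closer_iso; first exact: actXK.
- by move=> r a b; exact: actX_ball.
- by move=> a; exact: half_space_refl.
- by move=> b /(half_space_refl k); rewrite mulrN mulrA -expr2 sqrr_sign mul1r.
Qed.

Lemma sided_asym (i : 'I_n.+1) (c : 'I_(d - i)) y : sided 1 c y -> sided (-1) c y -> False.
Proof. by rewrite /sided opprK; exact: closer_asym. Qed.

Lemma flipK (k : 'I_n.+1) : involutive (flip k : W -> W).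
Proof.
by move=> w; apply/matrixP => i j; rewrite !flipE mulrA -expr2 sgn_sqr mul1r.
Qed.

Lemma equation_val_odd e (k : 'I_n.+1) w :
  equation_val e (flip k w) = (-1) ^+ equation_char e k * equation_val e w.
Proof.
case: e => [[i c]|[i j]].
  have cfE s : sided ((-1) ^+ equation_char (coord_eqn c) k * s) c (normalized (flip k w)) <->
      sided s c (normalized w).
    split; last exact: sided_flip.
    by move/(sided_flip k); rewrite flipK mulrA -expr2 sqrr_sign mul1r.
  change (equation_val (coord_eqn c) (flip k w) =
    (-1) ^+ equation_char (coord_eqn c) k * equation_val (coord_eqn c) w).
  move: (equation_char (coord_eqn c) k) cfE => b cfE.
  move: (cfE 1) (cfE (-1)); rewrite mulr1 mulrN1 {cfE}.
  have asym := @sided_asym i c (normalized w).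
  case: b; rewrite ?expr0 ?expr1 ?mul1r ?mulN1r ?opprK => e1 e2 /=.
    (* An odd character exchanges the two half-spaces. *)
    by rewrite -(side_swap _ asym); exact: eq_side.
  exact: eq_side.
rewrite /= mulr_sumr; apply: eq_bigr => c _; rewrite !tail_flip !ffunE !sgnE.
have kE (l : 'I_n) : (lift ord0 l == k) = (k == l.+1 :> nat) by rewrite eq_sym.
by rewrite !kE signr_addb mulrACA.
Qed.

(** The point lies in its own half-space, and by continuity of [f i] on frames a ball around it
    misses the opposite one; this decides [closer] at all nearby points, frames or not. *)
Lemma sided_near (s : R) (i : 'I_n.+1) (c : 'I_(d - i)) (w : W) :
  normalized x @[x --> w] --> normalized w ->
  X (normalized w) -> 0 < s * f i (normalized w) ord0 c ->
  \forall w' \near w, sided s c (normalized w').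
Proof.
move=> cw Xw sw; apply: (near_cvg (A := sided s c) cw).
have : nbhs (f i (normalized w)) [set v | 0 < s * v ord0 c].
  have sc : continuous (fun v : 'rV[R]_(d - i) => s * v ord0 c).
    by move=> v; apply: continuousM; [exact: cst_continuous|exact: coord_continuous].
  by have /cvgr_gt := sc (f i (normalized w)); exact.
move=> fpos; have : within X (nbhs (normalized w)) [set y | 0 < s * f i y ord0 c].
  by rewrite (nbhs_subspace_in Xw); exact: (@hcont i (normalized w) _ fpos).
move=> /nbhs_ballP[e /= e0 ye].
apply: (closer_near e0); first by split=> //; exact: ltW.
move=> b [Xb sb] /ye /(_ Xb) /=; move: sb; rewrite mulNr oppr_ge0 => sb.
by rewrite ltNge sb.
Qed.

Theorem equivariant_map_zero : exists p : P, X p /\ forall i, f i p = 0.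
Proof.
have DN i : (i < n.+1)%N -> (nth 0 (dims d n) i < d.+1)%N.
  by case: i => [|i] //= ; rewrite nth_nseq ltnS; case: ifP => // _ _; exact: leq_pred.
have [w [w0 ew]] := sign_change_exists (size_dims d n) DN equation_val_odd (reduces_equations nd).
have wj : exists j, w ord0 j != 0 by have [j _ wj] := w0 ord0; exists j.
have wt i : exists c, tail w i c != 0.
  (* The nonzero entry has index at most [d.-1], so it lies in a column kept by [tail]. *)
  have [j] := w0 (lift ord0 i); rewrite /= nth_nseq add0n ltn_ord => jd wij.
  have jd' : (j < d)%N by have := ltn_ord i; lia.
  exists (Ordinal jd'); rewrite /tail (_ : widen_ord _ _ = j) //; exact: val_inj.
(* These equations are continuous, so having no strict sign near [w] forces them to vanish at
   [w]. *)
have wo (i j : 'I_n) : (i < j)%N -> \sum_(c < d) tail w i c * tail w j c = 0.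
  move=> ij; have [npos nneg] := ew _ (orth_eqn_in d ij).
  have cv : continuous (fun x : W => \sum_(c < d) tail x i c * tail x j c).
    apply: continuous_big => [|c _ x]; first exact: add_continuous.
    by apply: continuousM; exact: coord_continuous.
  apply/eqP; case: ltgtP => // s0; exfalso.
    by apply: nneg; have /cvgr_lt := cv w; exact.
  by apply: npos; have /cvgr_gt := cv w; exact.
have Xw := normalized_frames wj wt wo.
have cw : normalized x @[x --> w] --> normalized w.
  apply: cvg_normalized => [|i].
    by have [j wj'] := wj; rewrite gt_eqF // sqrtr_gt0 (@sum_sqr_gt0 _ (fun j => w ord0 j) j wj').
  by have [c wc] := wt i; rewrite gt_eqF // sqrtr_gt0 (@sum_sqr_gt0 _ (tail w i) c wc).
exists (normalized w); split=> // i; apply/rowP => c; rewrite [RHS]mxE.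
(* A nonzero component of [f] at this frame would give its equation a strict sign all around [w]. *)
have [npos nneg] := ew _ (coord_eqn_in c).
apply/eqP; case: ltgtP => // fc; exfalso.
  apply: nneg; have := @sided_near (-1) i c w cw Xw.
  rewrite mulN1r oppr_gt0 => /(_ fc); apply: filterS => w' cl /=.
  rewrite side_swap ?oppr_lt0; first exact: side_gt0.
  by move=> cl1 cl2; exact: sided_asym cl2 cl1.
apply: npos; have := @sided_near 1 i c w cw Xw.
rewrite mul1r => /(_ fc); apply: filterS => w' cl /=.
exact: side_gt0.
Qed.

End Map.
End Frames.

(* f : X -> R = prod_(i=0..d-k) R^(d-i) is given by its components f i. *)
Theorem theorem2p1 (R : realType) (d k : nat) (hkd : (k <= d)%N)
  (f : forall i : 'I_(d - k).+1, 'rV[R]_d.+1 * 'M[R]_(d - k, d) -> 'rV[R]_(d - i))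
  (hcont : forall i, {within [set p | @sphere R d p.1 /\ @stiefel R (d - k) d p.2],
                      continuous (f i)})
  (hequiv : forall (g : Zgrp (d - k)) (p : 'rV[R]_d.+1 * 'M[R]_(d - k, d)),
      @sphere R d p.1 -> @stiefel R (d - k) d p.2 ->
      forall i, f i (actX g p) = actR g (f i p)) :
  exists p : 'rV[R]_d.+1 * 'M[R]_(d - k, d),
    [/\ @sphere R d p.1, @stiefel R (d - k) d p.2 & forall i, f i p = 0].
Proof.
by have [p [[p1 p2] p0]] := equivariant_map_zero (leq_subr k d) hcont hequiv; exists p.
Qed.
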